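(* Let $P$ be the marginal Metropolis--Hastings kernel with target $\pi$ and proposal $q$, and let $\tilde P$ be the associated pseudo-marginal kernel with weight distributions $\{Q_x\}_{x\in\mathsf X}$. Denote the expected acceptance rates of the two algorithms by $$\alpha_P := \int \pi(\mathrm dx)\int q(x,\mathrm dy)\min\{1,r(x,y)\},\qquad \alpha_{\tilde P} := \int\tilde\pi(\mathrm dx,\mathrm dw)\int q(x,\mathrm dy)Q_y(\mathrm du)\min\Bigl\{1,r(x,y)\frac{u}{w}\Bigr\}.$$ Then $$0\le \alpha_P-\alpha_{\tilde P}\le \int |w-1|\,\pi(\mathrm dx)\,(1-\rho(x))\,Q_x(\mathrm dw)\le \int |w-1|\,\pi(\mathrm dx)\,Q_x(\mathrm dw).$$
   Context: Let $(\mathsf X,\mathcal B(\mathsf X))$ be a measurable space, $\pi$ a probability measure on it and $q(x,\mathrm dy)$ a Markov kernel on $\mathsf X$. The function $r(x,y)=\frac{\pi(\mathrm dy)q(y,\mathrm dx)}{\pi(\mathrm dx)q(x,\mathrm dy)}$ is the Radon--Nikodym derivative in the sense of Tierney: there is a symmetric measurable set $R\subset\mathsf X^2$ on which the measures $\pi(\mathrm dx)q(x,\mathrm dy)$ and $\pi(\mathrm dy)q(y,\mathrm dx)$ are mutually absolutely continuous, and on whose complement they are mutually singular; on $R$, $r$ is the density of the second with respect to the first, with values in $(0,\infty)$ and $r(x,y)r(y,x)=1$; off $R$, $r:=0$. The marginal kernel is $P(x,\mathrm dy)=\min\{1,r(x,y)\}q(x,\mathrm dy)+\delta_x(\mathrm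 dy)\rho(x)$ with $\rho(x)=1-\int\min\{1,r(x,y)\}q(x,\mathrm dy)$. Let $\mathsf W$ be a Borel subset of $\mathbb R_+=[0,\infty)$ and let $x\mapsto Q_x$ be a probability kernel from $\mathsf X$ to $\mathsf W$ with $\int w\,Q_x(\mathrm dw)=1$ for all $x$. Put $\pi_x(\mathrm dw)=w\,Q_x(\mathrm dw)$ and $\tilde\pi(\mathrm dx,\mathrm dw)=\pi(\mathrm dx)\pi_x(\mathrm dw)$, a probability on $\mathsf X\times\mathsf W$. The pseudo-marginal kernel is $\tilde P(x,w;\mathrm dy,\mathrm du)=\min\{1,r(x,y)\frac uw\}q(x,\mathrm dy)Q_y(\mathrm du)+\delta_{x,w}(\mathrm dy,\mathrm du)\tilde\rho(x,w)$ with $\tilde\rho(x,w)=1-\iint\min\{1,r(x,y)\frac uw\}q(x,\mathrm dy)Q_y(\mathrm du)$. (If $0\in\mathsf W$, read $\min\{1,r(x,y)u/w\}$ as $1$ for $w=0$; the set $\{w=0\}$ is $\tilde\pi$-null.) *)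

(* Defs.v *)
(* MathComp-Analysis *)
From HB Require Import structures.
From mathcomp Require Import all_boot all_order all_algebra.
From mathcomp Require Import all_classical all_reals all_analysis.

Set Implicit Arguments.
Unset Strict Implicit.
Unset Printing Implicit Defensive.
Import Order.TTheory GRing.Theory Num.Theory.

Local Open Scope classical_set_scope.
Local Open Scope ring_scope.
Local Open Scope ereal_scope.

Section semidirect.
Context d d' (X : measurableType d) (Y : measurableType d') (R : realType).

(* The measure m(dx) k(x, dy) on X * Y. *)
Definition semidirect (m : set X -> \bar R) (k : X -> set Y -> \bar R)
    (A : set (X * Y)) : \bar R :=
  \int[m]_x k x (xsection A x).

End semidirect.

Section marginal.
Context d (X : measurableType d) (R : realType).
Variables (pi : probability X R) (q : R.-pker X ~> X).

(* r is the ratio pi(dy) q(y, dx) / (pi(dx) q(x, dy)) in the sense of Tierney: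
   mu is pi(dx) q(x, dy), and nu, its image under (x, y) |-> (y, x), is
   pi(dy) q(y, dx). *)
Definition tierney_ratio (r : X -> X -> R) : Prop :=
  let mu := semidirect pi (fun x => q x) in
  let nu := pushforward mu (fun z : X * X => (z.2, z.1)) in
  measurable_fun [set: X * X] (fun z => r z.1 z.2) /\
  exists S : set (X * X),
    [/\ measurable S,
        forall x y, S (x, y) -> S (y, x),
        forall A, measurable A -> A `<=` S -> mu A = 0 <-> nu A = 0,
        exists N, [/\ measurable N, N `<=` ~` S, mu N = 0 & nu (~` S `\` N) = 0]
      & [/\ forall A, measurable A -> A `<=` S ->
              nu A = \int[mu]_(z in A) (r z.1 z.2)%:E,
            forall x y, S (x, y) -> (0 < r x y)%R /\ (r x y * r y x = 1)%R
          & forall x y, ~ S (x, y) -> r x y = 0%R]].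

Variable r : X -> X -> R.

Definition mh_accept (x y : X) : R := Num.min 1%R (r x y).

Definition mh_rejection (x : X) : \bar R := 1 - \int[q x]_y (mh_accept x y)%:E.

Definition mh_rate : \bar R := \int[pi]_x \int[q x]_y (mh_accept x y)%:E.

End marginal.

(* A kernel from X to a Borel set W of reals is represented by a kernel Q from X
   to R such that Q x (~` W) = 0 for all x. *)
Section pseudo_marginal.
Context d (X : measurableType d) (R : realType).
Variables (pi : probability X R) (q : R.-pker X ~> X).
Variables (W : set R) (Q : R.-pker X ~> measurableTypeR R) (r : X -> X -> R).

(* The measure w Q_x(dw), carried by W. *)
Definition weighted (x : X) (A : set (measurableTypeR R)) : \bar R :=
  \int[Q x]_(w in A `&` W) w%:E.

Definition pm_target : set (X * measurableTypeR R) -> \bar R :=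
  semidirect pi weighted.

(* min{1, r(x, y) u / w}, read as 1 at w = 0 (a pm_target-null set). *)
Definition pm_accept (x : X) (w : R) (y : X) (u : R) : R :=
  if w == 0%R then 1%R else Num.min 1%R (r x y * (u / w))%R.

Definition pm_rate : \bar R :=
  \int[pm_target]_(z in [set: X] `*` W)
    \int[q z.1]_y \int[Q y]_(u in W) (pm_accept z.1 z.2 y u)%:E.

End pseudo_marginal.

(* Main.v *)
Require Import Defs.
From HB Require Import structures.
From mathcomp Require Import all_boot all_order all_algebra.
From mathcomp Require Import all_classical all_reals all_analysis.
From mathcomp Require Import measurable_realfun ring lra.
Import Order.TTheory GRing.Theory Num.Theory.
Local Open Scope classical_set_scope.
Local Open Scope ring_scope.
Local Open Scope ereal_scope.

(** Write a(x,y) = min(1, r(x,y)) and w+ = max(w, 0).  The target of the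
    pseudo-marginal chain carries the weight w, and
    w min(1, r u / w) = min(w, r u) for w >= 0, so after exchanging the
    integrals over w and y both acceptance rates are integrals against the same
    measure mu(dx,dy) = pi(dx) q(x,dy): that of the marginal chain integrates
    a(x,y), that of the pseudo-marginal chain integrates
    H(x,y) = E min(w, r(x,y) u), where w ~ Q_x and u ~ Q_y are independent
    (pm_rateE).

    Lower bound.  Since w and u have mean one, H(x,y) is at most 1 and at most
    r(x,y), hence at most a(x,y) (mean_min_le).

    Upper bound.  As a <= 1 and a <= r, one has min(w, r u) >= a min(w, u) and
    therefore a <= min(w, r u) + a (1 - w)+ + a (1 - u)+.  Averaging,
    a(x,y) <= H(x,y) + a(x,y) G(x) + a(x,y) G(y), where G(x) = E (1 - w)+ is the
    mean deficit (mh_accept_le_mean_min).  Because a mu is a symmetric measure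
    (detailed_balance), the terms with G(x) and G(y) have the same mu-integral.
    Finally |w - 1| + 1 = w + 2 (1 - w)+ and E w = 1 give E |w - 1| = 2 G(x)
    (mean_deviationE), so that the two terms add up to the integral of
    a(x,y) E_x |w - 1|, which is the announced bound.  The last inequality
    of the theorem is 1 - rho(x) <= 1.

    The measures involved (the joint law of a state and its proposal, the target
    of the pseudo-marginal chain, and the image of mu under the exchange of
    coordinates) are given as set functions.  Integrals
    against them are computed by the principle that a functional on
    nonnegative measurable functions which is additive, homogeneous, monotone
    and continuous along nondecreasing sequences is determined by its values on
    indicators (integral_like_unique, integral_likeE). *)

Set Implicit Arguments.
Unset Strict Implicit.
Unset Printing Implicit Defensive.

(** * Functionals that behave like integrals *)

Definition ge0_measurable d (T : measurableType d) (R : realType)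
    (f : T -> \bar R) : Prop :=
  measurable_fun [set: T] f /\ forall x, 0 <= f x.

(** The properties of the map sending f to its integral, the domain being the
    nonnegative measurable functions.  Countable additivity is expressed by
    the last field, monotone convergence. *)
Record integral_like d (T : measurableType d) (R : realType)
    (L : (T -> \bar R) -> \bar R) : Prop := IntegralLike {
  integral_likeD : forall f g, ge0_measurable f -> ge0_measurable g ->
    L (fun x => f x + g x) = L f + L g ;
  integral_likeZ : forall (c : R) f, (0 <= c)%R -> ge0_measurable f ->
    L (fun x => c%:E * f x) = c%:E * L f ;
  integral_like_le : forall f g, ge0_measurable f -> ge0_measurable g ->
    (forall x, f x <= g x) -> L f <= L g ;
  integral_like_lim : forall f : (T -> \bar R)^nat,
    (forall n, ge0_measurable (f n)) ->
    (forall x, nondecreasing_seq (f ^~ x)) ->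
    L (fun x => limn (f ^~ x)) = limn (fun n => L (f n)) }.

Section ge0_measurable_closure.
Context d (T : measurableType d) (R : realType).
Implicit Types f g : T -> \bar R.

Lemma ge0_measurable_indic (A : set T) : measurable A ->
  ge0_measurable (fun x => (\1_A x : R)%:E).
Proof.
move=> mA; split => [|x]; last by rewrite lee_fin.
by apply/measurable_EFinP; exact: measurable_indic.
Qed.

Lemma ge0_measurableD f g : ge0_measurable f -> ge0_measurable g ->
  ge0_measurable (fun x => f x + g x).
Proof.
move=> [mf f0] [mg g0]; split => [|x]; last exact: adde_ge0.
exact: emeasurable_funD.
Qed.

Lemma ge0_measurableM f g : ge0_measurable f -> ge0_measurable g ->
  ge0_measurable (fun x => f x * g x).
Proof.
move=> [mf f0] [mg g0]; split => [|x]; last exact: mule_ge0.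
exact: emeasurable_funM.
Qed.

Lemma ge0_measurable_cst (c : \bar R) : 0 <= c ->
  @ge0_measurable _ T R (fun=> c).
Proof. by move=> c0; split. Qed.

Lemma ge0_measurable_sum (I : Type) (s : seq I) (F : I -> T -> \bar R) :
  (forall i, ge0_measurable (F i)) ->
  ge0_measurable (fun x => \sum_(i <- s) F i x).
Proof.
move=> F0; split => [|x].
  by apply: emeasurable_sum => i; exact: (F0 i).1.
by apply: sume_ge0 => i _; exact: (F0 i).2.
Qed.

End ge0_measurable_closure.

Section integral_like_theory.
Context d (T : measurableType d) (R : realType).
Variable L : (T -> \bar R) -> \bar R.
Hypothesis HL : integral_like L.

Lemma integral_like0 : L (fun=> 0) = 0.
Proof.
have := integral_likeZ HL (lexx 0%R) (ge0_measurable_cst T (lexx (0 : \bar R))).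
by under eq_fun do rewrite mul0e; rewrite mul0e.
Qed.

Lemma integral_like_ge0 f : ge0_measurable f -> 0 <= L f.
Proof.
move=> f0; rewrite -integral_like0.
by apply: (integral_like_le HL) => //; exact: f0.2.
Qed.

Lemma integral_like_sum (I : Type) (s : seq I) (F : I -> T -> \bar R) :
  (forall i, ge0_measurable (F i)) ->
  L (fun x => \sum_(i <- s) F i x) = \sum_(i <- s) L (F i).
Proof.
move=> F0; elim: s => [|i s IHs].
  by rewrite big_nil; under eq_fun do rewrite big_nil; exact: integral_like0.
rewrite big_cons -IHs -(integral_likeD HL) //; last exact: ge0_measurable_sum.
by congr L; apply/funext => x; rewrite big_cons.
Qed.

End integral_like_theory.

Section integral_like_unique.
Context d (T : measurableType d) (R : realType).
Variables L1 L2 : (T -> \bar R) -> \bar R.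
Hypotheses (HL1 : integral_like L1) (HL2 : integral_like L2).
Hypothesis L12 : forall A, measurable A ->
  L1 (fun x => (\1_A x)%:E) = L2 (fun x => (\1_A x)%:E).

Import HBNNSimple.

(** Simple functions are nonnegative combinations of indicators, and every
    nonnegative measurable function is the limit of a nondecreasing sequence of
    simple functions. *)
Lemma integral_like_unique f : ge0_measurable f -> L1 f = L2 f.
Proof.
move=> [mf f0]; pose h := nnsfun_approx measurableT mf.
have hE : f = fun x => limn (fun n => (h n x)%:E).
  apply/funext => x; apply/esym/cvg_lim => //.
  by apply: cvg_nnsfun_approx.
have h0 n : ge0_measurable (fun x => (h n x)%:E).
  by split => [|x]; [exact/measurable_EFinP|rewrite lee_fin].
have ndh x : nondecreasing_seq (fun n => (h n x)%:E).
  by move=> m n mn; rewrite lee_fin; exact/lefP/nd_nnsfun_approx.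
rewrite hE (integral_like_lim HL1)// (integral_like_lim HL2)//.
apply: congr_lim; apply/funext => n.
(* The values r are nonnegative on the range; the absolute value makes every
   summand a nonnegative function without that information. *)
pose F (r : R) (x : T) : \bar R := `|r|%:E * (\1_(h n @^-1` [set r]) x)%:E.
have I0 r : ge0_measurable (fun x => (\1_(h n @^-1` [set r]) x : R)%:E).
  exact: ge0_measurable_indic.
have F0 r : ge0_measurable (F r).
  by apply: ge0_measurableM => //; exact: ge0_measurable_cst.
have -> : (fun x => (h n x)%:E) =
    (fun x => \sum_(r <- finmap.enum_fset (fset_set (range (h n)))) F r x).
  apply/funext => x; rewrite [in LHS]fimfunE fsbig_finite//= -sumEFin.
  rewrite big_seq [RHS]big_seq; apply: eq_bigr => r.
  rewrite in_fset_set// inE => -[y _ <-].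
  by rewrite /F ger0_norm.
rewrite (integral_like_sum HL1)// (integral_like_sum HL2)//.
by apply: eq_bigr => r _; rewrite (integral_likeZ HL1)// (integral_likeZ HL2)// L12.
Qed.

End integral_like_unique.

Section integral_like_integral.
Context d (T : measurableType d) (R : realType).

Lemma integral_like_measure (m : {measure set T -> \bar R}) :
  integral_like (fun f => \int[m]_x f x).
Proof.
split.
- by move=> f g [mf f0] [mg g0]; rewrite ge0_integralD.
- by move=> c f c0 [mf f0]; rewrite ge0_integralZl_EFin.
- by move=> f g [mf f0] [mg g0] fg; apply: ge0_le_integral.
- move=> f f0 ndf; rewrite monotone_convergence//.
  + by move=> n; exact: (f0 n).1.
  + by move=> n x _; exact: (f0 n).2.
Qed.

(* [mu] is a bare set function: its countable additivity is inherited from the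
   monotone continuity of [L]. *)
Variables (mu : set T -> \bar R) (L : (T -> \bar R) -> \bar R).
Hypotheses (HL : integral_like L) (mu_ge0 : forall A, 0 <= mu A).
Hypothesis muE : forall A, measurable A -> mu A = L (fun x => (\1_A x)%:E).

Let mu0 : mu set0 = 0.
Proof.
rewrite muE// -(integral_like0 HL); congr L.
by apply/funext => x; rewrite indic0.
Qed.

Let mu_sigma_additive : semi_sigma_additive mu.
Proof.
move=> F mF tF mUF.
have F0 n : ge0_measurable (fun x => \sum_(0 <= i < n) (\1_(F i) x : R)%:E).
  by apply: ge0_measurable_sum => i; exact: ge0_measurable_indic.
have -> : mu (\bigcup_n F n) = limn (fun n => \sum_(0 <= i < n) mu (F i)).
  rewrite muE//.
  (* The indicator of a disjoint union is the sum of the indicators: this is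
     the countable additivity of the Dirac measure at each point. *)
  transitivity (L (fun x => limn (fun n => \sum_(0 <= i < n) (\1_(F i) x)%:E))).
    congr L; apply/funext => x; apply/esym/cvg_lim => //.
    exact: (@measure_semi_sigma_additive _ _ _ (dirac x : {measure set T -> \bar R})).
  rewrite (integral_like_lim HL)//; last first.
    by move=> x; apply: ereal_nondecreasing_series => n _; rewrite lee_fin.
  apply: congr_lim; apply/funext => n; rewrite (integral_like_sum HL).
    by apply: eq_bigr => i _; rewrite muE.
  by move=> i; exact: ge0_measurable_indic.
apply: ereal_nondecreasing_is_cvgn.
by apply: ereal_nondecreasing_series => n _.
Qed.

(** [mu] is a measure, so its integral is an integral-like functional that
    agrees with [L] on indicators. *)
Lemma integral_likeE f : ge0_measurable f -> \int[mu]_x f x = L f.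
Proof.
pose mu_isMeasure := isMeasure.Build _ _ _ mu mu0 mu_ge0 mu_sigma_additive.
pose m : {measure set T -> \bar R} := HB.pack mu mu_isMeasure.
apply: (integral_like_unique (integral_like_measure m)) => // A mA.
by rewrite integral_indic// setIT; exact: muE.
Qed.

End integral_like_integral.

(** * Integrals against kernels and semidirect products *)

(** A kernel reindexed along a measurable map is a kernel, which yields the
    measurability of integrals whose measure depends on some coordinates only. *)
Section kernel_pullback.
Context d1 d2 d3 (Z : measurableType d1) (X : measurableType d2)
  (Y : measurableType d3) (R : realType).
Variables (k : R.-pker X ~> Y) (phi : Z -> X).
Hypothesis mphi : measurable_fun [set: Z] phi.

Lemma ge0_measurable_integral_kernel (f : Z * Y -> \bar R) : ge0_measurable f ->
  ge0_measurable (fun z => \int[k (phi z)]_y f (z, y)).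
Proof.
move=> [mf f0]; split => [|z]; last by apply: integral_ge0 => y _.
pose kphi (z : Z) : {measure set Y -> \bar R} := k (phi z).
have mkphi U : measurable U -> measurable_fun [set: Z] (kphi ^~ U).
  by move=> mU; exact: measurableT_comp (measurable_kernel k U mU) mphi.
have kphiT z : kphi z [set: Y] = 1 by exact: prob_kernel.
pose K : R.-ker Z ~> Y := HB.pack kphi (isKernel.Build _ _ _ _ _ kphi mkphi).
pose P : R.-pker Z ~> Y := HB.pack (Kernel.sort K)
  (Kernel_isProbability.Build _ _ _ _ _ K kphiT).
exact: (measurable_fun_integral_finite_kernel f P).
Qed.

End kernel_pullback.

Lemma ge0_measurable_comp d1 d2 (T : measurableType d1) (U : measurableType d2)
    (R : realType) (f : U -> \bar R) (phi : T -> U) :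
  measurable_fun [set: T] phi -> ge0_measurable f ->
  ge0_measurable (fun x => f (phi x)).
Proof. by move=> mphi [mf f0]; split => // ; exact: measurableT_comp. Qed.

Lemma ge0_measurable_EFin d (T : measurableType d) (R : realType) (g : T -> R) :
  measurable_fun [set: T] g -> (forall x, (0 <= g x)%R) ->
  ge0_measurable (fun x => (g x)%:E).
Proof. by move=> mg g0; split => [|x]; [exact/measurable_EFinP|rewrite lee_fin]. Qed.

Lemma integral_kernel_cst d1 d2 (X : measurableType d1) (Y : measurableType d2)
    (R : realType) (k : R.-pker X ~> Y) x (c : \bar R) :
  \int[k x]_y c = c.
Proof. by rewrite integral_cst// prob_kernel mule1. Qed.

Section integral_like_closure.
Context d d' (T : measurableType d) (U : measurableType d') (R : realType).

Lemma integral_like_pushforward (L : (T -> \bar R) -> \bar R) (phi : T -> U) :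
  integral_like L -> measurable_fun [set: T] phi ->
  integral_like (fun f => L (fun x => f (phi x))).
Proof.
move=> HL mphi; split => [f g f0 g0|c f c0 f0|f g f0 g0 fg|f f0 ndf].
- by rewrite (integral_likeD HL)//; exact: ge0_measurable_comp.
- by rewrite (integral_likeZ HL)//; exact: ge0_measurable_comp.
- by apply: (integral_like_le HL) => //; exact: ge0_measurable_comp.
- by rewrite -(integral_like_lim HL)// => n; exact: ge0_measurable_comp.
Qed.

Lemma integral_like_density (L : (T -> \bar R) -> \bar R) (g : T -> R) :
  integral_like L -> measurable_fun [set: T] g -> (forall x, (0 <= g x)%R) ->
  integral_like (fun f => L (fun x => (g x)%:E * f x)).
Proof.
move=> HL mg g0.
have gM f : ge0_measurable f -> ge0_measurable (fun x => (g x)%:E * f x).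
  by apply: ge0_measurableM; exact: ge0_measurable_EFin.
split => [f h f0 h0|c f c0 f0|f h f0 h0 fh|f f0 ndf].
- rewrite -(integral_likeD HL)//; try exact: gM.
  by congr L; apply/funext => x; rewrite ge0_muleDr//; [exact: f0.2|exact: h0.2].
- rewrite -(integral_likeZ HL)//; last exact: gM.
  by congr L; apply/funext => x; rewrite muleCA.
- apply: (integral_like_le HL); [exact: gM|exact: gM|move=> x].
  by rewrite lee_wpmul2l// lee_fin.
- rewrite -(integral_like_lim HL); last 2 first.
  + by move=> n; exact: gM.
  + by move=> x m n mn; rewrite lee_wpmul2l ?lee_fin//; exact: ndf.
  congr L; apply/funext => x; rewrite limeMl//.
  exact: ereal_nondecreasing_is_cvgn.
Qed.

Lemma integral_like_iterated (m : {measure set T -> \bar R})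
    (L : T -> (U -> \bar R) -> \bar R) :
  (forall x, integral_like (L x)) ->
  (forall f : T * U -> \bar R, ge0_measurable f ->
    measurable_fun [set: T] (fun x => L x (fun y => f (x, y)))) ->
  integral_like (fun f => \int[m]_x L x (fun y => f (x, y))).
Proof.
move=> HL mL.
have section_ge0 (f : T * U -> \bar R) x : ge0_measurable f ->
    ge0_measurable (fun y => f (x, y)).
  by apply: ge0_measurable_comp; exact: pair1_measurable.
have Lge0 (f : T * U -> \bar R) : ge0_measurable f ->
    ge0_measurable (fun x => L x (fun y => f (x, y))).
  move=> f0; split => [|x]; first exact: mL.
  by apply: (integral_like_ge0 (HL x)); exact: section_ge0.
have Hm := integral_like_measure m.
split => [f g f0 g0|c f c0 f0|f g f0 g0 fg|f f0 ndf].
- rewrite -(integral_likeD Hm); try exact: Lge0.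
  apply: eq_integral => x _.
  by rewrite (integral_likeD (HL x))//; exact: section_ge0.
- rewrite -(integral_likeZ Hm)//; last exact: Lge0.
  apply: eq_integral => x _.
  by rewrite (integral_likeZ (HL x))//; exact: section_ge0.
- apply: (integral_like_le Hm); [exact: Lge0|exact: Lge0|move=> x].
  by apply: (integral_like_le (HL x)) => //; exact: section_ge0.
- rewrite -(integral_like_lim Hm); last 2 first.
  + by move=> n; exact: Lge0.
  + move=> x a b ab; apply: (integral_like_le (HL x)) => [| |y].
    * exact: section_ge0.
    * exact: section_ge0.
    * exact: ndf.
  apply: eq_integral => x _; rewrite -(integral_like_lim (HL x))//.
  by move=> n; exact: section_ge0.
Qed.

(** Describing the family [k] by functionals [L x], rather than as a kernel of
    measures, covers families with a density such as w Q_x(dw). *)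
Section semidirect_integral.
Variables (m : {measure set T -> \bar R}) (k : T -> set U -> \bar R).
Variable L : T -> (U -> \bar R) -> \bar R.
Hypothesis k_ge0 : forall x A, 0 <= k x A.
Hypothesis kE : forall x A, measurable A -> k x A = L x (fun y => (\1_A y)%:E).
Hypothesis HL : forall x, integral_like (L x).
Hypothesis measurable_L : forall f : T * U -> \bar R, ge0_measurable f ->
  measurable_fun [set: T] (fun x => L x (fun y => f (x, y))).

Lemma semidirectE A : measurable A ->
  semidirect m k A = \int[m]_x L x (fun y => (\1_A (x, y))%:E).
Proof.
move=> mA; apply: eq_integral => x _; rewrite kE; last exact: measurable_xsection.
congr L; apply/funext => y; congr (_%:E); rewrite !indicE; congr ((_ : bool)%:R).
by rewrite mem_xsection.
Qed.

Lemma integral_semidirect f : ge0_measurable f ->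
  \int[semidirect m k]_z f z = \int[m]_x L x (fun y => f (x, y)).
Proof.
apply: (integral_likeE (integral_like_iterated m HL measurable_L)) => [A|A].
  by rewrite /semidirect; apply: integral_ge0.
exact: semidirectE.
Qed.

End semidirect_integral.

End integral_like_closure.

(** * Detailed balance of the marginal chain *)

Section detailed_balance.
Context d (X : measurableType d) (R : realType).
Variables (pi : probability X R) (q : R.-pker X ~> X) (r : X -> X -> R).
Hypothesis hr : tierney_ratio pi q r.

Lemma measurable_ratio : measurable_fun [set: X * X] (fun z => r z.1 z.2).
Proof. by case: hr. Qed.

Lemma ratio_ge0 x y : (0 <= r x y)%R.
Proof.
have [_ [S [_ _ _ _ [_ rS rNS]]]] := hr.
by have [/rS[/ltW]|/rNS->] := pselect (S (x, y)).
Qed.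

Lemma mh_accept_ge0 x y : (0 <= mh_accept r x y)%R.
Proof. by rewrite le_min ler01 ratio_ge0. Qed.

Lemma mh_accept_le1 x y : (mh_accept r x y <= 1)%R.
Proof. by rewrite ge_min lexx. Qed.

Lemma measurable_mh_accept :
  measurable_fun [set: X * X] (fun z => mh_accept r z.1 z.2).
Proof. by apply: measurable_minr => //; exact: measurable_ratio. Qed.

Lemma ge0_measurable_mh_accept :
  ge0_measurable (fun z : X * X => (mh_accept r z.1 z.2)%:E).
Proof.
apply: ge0_measurable_EFin; first exact: measurable_mh_accept.
by move=> z; exact: mh_accept_ge0.
Qed.

(** The integral against pi(dx) q(x, dy). *)
Definition proposal_integral (f : X * X -> \bar R) : \bar R :=
  \int[pi]_x \int[q x]_y f (x, y).

Lemma integral_like_proposal : integral_like proposal_integral.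
Proof.
apply: (integral_like_iterated pi (L := fun x f => \int[q x]_y f y)).
  by move=> x; exact: integral_like_measure.
by move=> f f0; exact: (ge0_measurable_integral_kernel q (@measurable_id _ X setT) f0).1.
Qed.

Let mu := semidirect pi (fun x => q x).

Let muE A : measurable A -> mu A = proposal_integral (fun z => (\1_A z)%:E).
Proof.
apply: (semidirectE pi (L := fun x f => \int[q x]_y f y)) => x B mB.
by rewrite integral_indic// setIT.
Qed.

Let integral_mu f : ge0_measurable f -> \int[mu]_z f z = proposal_integral f.
Proof.
apply: (integral_semidirect pi (L := fun x f => \int[q x]_y f y)).
- by move=> x A; exact: measure_ge0.
- by move=> x A mA; rewrite integral_indic// setIT.
- by move=> x; exact: integral_like_measure.
- by move=> g g0; exact: (ge0_measurable_integral_kernel q (@measurable_id _ X setT) g0).1.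
Qed.

Let measurable_swapXX :
  measurable_fun [set: X * X] (fun z : X * X => (z.2, z.1)).
Proof. exact: measurable_swap. Qed.

(** Only the set S where r is positive contributes.  There, r is the density of
    the image nu of mu under the exchange of coordinates, whence
    int a(x,y) f(y,x) dmu = int a(y,x) f(x,y) dnu = int r(x,y) a(y,x) f(x,y) dmu,
    and r(x,y) min(1, r(y,x)) = min(r(x,y), 1) because r(x,y) r(y,x) = 1. *)
Lemma detailed_balance f : ge0_measurable f ->
  proposal_integral (fun z => (mh_accept r z.1 z.2)%:E * f (z.2, z.1)) =
  proposal_integral (fun z => (mh_accept r z.1 z.2)%:E * f z).
Proof.
have [_ [S [mS symS _ _ [nuS rS rNS]]]] := hr.
move=> f0.
have r0 := ratio_ge0.
have acceptNS x y : (x, y) \notin S -> mh_accept r x y = 0%R.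
  by move=> /negP; rewrite inE => /rNS rxy; rewrite /mh_accept rxy min_r.
(* Integration against the restriction of nu to S, in two ways: by change of
   variables and by the density r, which vanishes off S. *)
pose L1 (g : X * X -> \bar R) :=
  proposal_integral (fun z => (\1_S z)%:E * g (z.2, z.1)).
pose L2 (g : X * X -> \bar R) :=
  proposal_integral (fun z => (r z.1 z.2)%:E * g z).
have HL1 : integral_like L1.
  apply: (integral_like_pushforward (phi := fun z : X * X => (z.2, z.1))
    (L := fun g => proposal_integral (fun z => (\1_S z)%:E * g z))).
    exact: integral_like_density integral_like_proposal _ _.
  exact: measurable_swapXX.
have HL2 : integral_like L2.
  apply: integral_like_density integral_like_proposal _ _ => //.
  exact: measurable_ratio.
have L12 A : measurable A -> L1 (fun x => (\1_A x)%:E) = L2 (fun x => (\1_A x)%:E).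
  move=> mA; have mAS : measurable (A `&` S) by exact: measurableI.
  transitivity (pushforward mu (fun z : X * X => (z.2, z.1)) (A `&` S)).
    rewrite /pushforward muE; last first.
      by rewrite -[X in measurable X]setTI; exact: measurable_swapXX.
    congr proposal_integral; apply/funext => -[x y].
    rewrite -EFinM !indicE -natrM mulnb; congr ((_ : bool)%:R%:E).
    apply/idP/idP => [/andP[/set_mem Sxy /set_mem Ayx]|/set_mem[Ayx Syx]].
      by apply/mem_set; split => //; exact: symS.
    by apply/andP; split; apply/mem_set => //; exact: symS.
  rewrite (nuS _ mAS (@subIsetr _ A S)).
  rewrite /L2 -integral_mu; last first.
    apply: ge0_measurableM; last exact: ge0_measurable_indic.
    by apply: ge0_measurable_EFin => //; exact: measurable_ratio.
  rewrite /integral !patch_setT.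
  suff -> : (fun z => (r z.1 z.2)%:E) \_ (A `&` S) =
      (fun z => (r z.1 z.2)%:E * (\1_A z)%:E) by [].
  apply/funext => -[x y]; rewrite patchE indicE in_setI.
  have [Sxy|/negP Sxy] := boolP ((x, y) \in S); rewrite ?(andbT,andbF)/=.
    by case: ifP => _; rewrite ?mule1 ?mule0.
  by rewrite rNS ?mul0e// => /mem_set.
pose h z := (mh_accept r z.2 z.1)%:E * f z.
have h0 : ge0_measurable h.
  apply: ge0_measurableM => //.
  exact: (ge0_measurable_comp measurable_swapXX ge0_measurable_mh_accept).
transitivity (L1 h).
  congr proposal_integral; apply/funext => -[x y]; rewrite /h/= indicE.
  by have [Sxy|Sxy] := boolP ((x, y) \in S); rewrite ?mul1e// acceptNS// !mul0e ?mule0.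
rewrite (integral_like_unique HL1 HL2)//.
congr proposal_integral; apply/funext => -[x y]; rewrite /h/= muleA -EFinM.
congr (_%:E * _); have [/set_mem Sxy|Sxy] := boolP ((x, y) \in S).
  have [rxy0 rxyx] := rS _ _ Sxy.
  by rewrite /mh_accept minr_pMr 1?ltW// mulr1 rxyx minC.
by rewrite (acceptNS x y)// rNS ?mul0r// => /mem_set; exact/negP.
Qed.

End detailed_balance.

(** * Weights with mean one *)

(** The integrand can be changed freely off the carrier: this is how functions
    that are nonnegative only on the set of weights are replaced by functions
    that are nonnegative everywhere. *)
Lemma integral_carrier d (T : measurableType d) (R : realType)
    (m : {measure set T -> \bar R}) (W : set T) (f g : T -> \bar R) :
  measurable W -> m (~` W) = 0 -> ge0_measurable g ->
  (forall w, W w -> f w = g w) ->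
  \int[m]_(w in W) f w = \int[m]_w g w.
Proof.
move=> mW mW0 [mg g0] fg.
have nW := ge0_negligible_integral (measurableC mW) measurableT mg (fun x _ => g0 x) mW0.
rewrite nW setTD setCK; apply: eq_integral => w /set_mem; exact: fg.
Qed.

Section weights.
Context (R : realType).
Implicit Types w u r : R.

(** Replacing w by its positive part makes the integrands nonnegative outside of
    the set of weights without changing them on it. *)
Definition pos_part w : R := Num.max w 0%R.

Lemma pos_part_ge0 w : (0 <= pos_part w)%R.
Proof. by rewrite le_max lexx orbT. Qed.

Lemma pos_part_id w : (0 <= w)%R -> pos_part w = w.
Proof. by move=> w0; rewrite /pos_part max_l. Qed.

Lemma measurable_pos_part : measurable_fun [set: measurableTypeR R] pos_part.
Proof. exact: measurable_maxr. Qed.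

(** The arguments of the minimum are at least m w and m u, and
    m - m w = m (1 - w) is at most m times the deficit (1 - w)+. *)
Lemma le_min_add_deficits (m r w u : R) : (0 <= m)%R -> (m <= 1)%R -> (m <= r)%R ->
  (0 <= w)%R -> (0 <= u)%R ->
  (m <= Num.min w (r * u) + (m * Num.max (1 - w) 0 + m * Num.max (1 - u) 0))%R.
Proof.
move=> m0 m1 mr w0 u0.
have mw : (m * w <= w)%R by rewrite ler_piMl.
have mu : (m * u <= r * u)%R by rewrite ler_wpM2r.
have w1 : (m * (1 - w) <= m * Num.max (1 - w) 0)%R by rewrite ler_wpM2l// le_max lexx.
have u1 : (m * (1 - u) <= m * Num.max (1 - u) 0)%R by rewrite ler_wpM2l// le_max lexx.
have w2 : (0 <= m * Num.max (1 - w) 0)%R by rewrite mulr_ge0// le_max lexx orbT.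
have u2 : (0 <= m * Num.max (1 - u) 0)%R by rewrite mulr_ge0// le_max lexx orbT.
by rewrite /Num.min; case: ifP => _; lra.
Qed.

Lemma abs_sub1_deficit w :
  (`|w - 1| + 1 = w + (Num.max (1 - w) 0 + Num.max (1 - w) 0))%R.
Proof.
have [w1|w1] := leP 1%R w.
  by rewrite max_r ?subr_le0// ger0_norm ?subr_ge0//; lra.
by rewrite max_l ?subr_ge0 1?ltW// ltr0_norm ?subr_lt0//; lra.
Qed.

(** Multiplying by the weight removes the division; at w = 0 both sides vanish,
    so the convention chosen there for the acceptance probability is harmless. *)
Lemma weight_pm_accept d (X : measurableType d) (r : X -> X -> R) (x y : X) (w u : R) :
  (0 <= r x y)%R -> (0 <= w)%R -> (0 <= u)%R ->
  (w * pm_accept r x w y u = Num.min w (r x y * u))%R.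
Proof.
move=> r0 w0 u0; rewrite /pm_accept; case: eqP => [->|/eqP wN0].
  by rewrite mul0r min_l// mulr_ge0.
rewrite minr_pMr// mulr1; congr Num.min; by field.
Qed.

End weights.

Section mean_deviation.
Context d (X : measurableType d) (R : realType).
Variables (W : set (measurableTypeR R)) (Q : R.-pker X ~> measurableTypeR R).
Hypothesis mW : measurable W.
Hypothesis W_ge0 : forall w : R, W w -> (0 <= w)%R.
Hypothesis QW : forall x, Q x (~` W) = 0.
Hypothesis Q_mean1 : forall x, \int[Q x]_(w in W) w%:E = 1.

Local Notation mR := (measurableTypeR R).

Lemma ge0_measurable_pos_part :
  @ge0_measurable _ mR R (fun w => (pos_part w)%:E).
Proof.
apply: (@ge0_measurable_EFin _ mR R _ (@measurable_pos_part R)) => w.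
exact: pos_part_ge0.
Qed.

Lemma mean_pos_part x : \int[Q x]_w (pos_part w)%:E = 1.
Proof.
rewrite -(Q_mean1 x); apply/esym/integral_carrier => //.
  exact: ge0_measurable_pos_part.
by move=> w /W_ge0 w0; rewrite pos_part_id.
Qed.

Definition mean_deviation x : \bar R := \int[Q x]_w `|pos_part w - 1|%:E.

Definition mean_deficit x : \bar R := \int[Q x]_w (Num.max (1 - pos_part w) 0)%:E.

Lemma ge0_measurable_deficit :
  @ge0_measurable _ mR R (fun w => (Num.max (1 - pos_part w) 0)%:E).
Proof.
apply: ge0_measurable_EFin => [|w]; last by rewrite le_max lexx orbT.
by apply: measurable_maxr => //; apply: measurable_funB => //; exact: measurable_pos_part.
Qed.

Lemma ge0_measurable_deviation :
  @ge0_measurable _ mR R (fun w => `|pos_part w - 1|%:E).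
Proof.
apply: ge0_measurable_EFin => // .
apply: measurableT_comp => //.
by apply: measurable_funB => //; exact: measurable_pos_part.
Qed.

(** The excess and the deficit of a variable with mean one have equal means, and
    the absolute deviation is their sum. *)
Lemma mean_deviationE x : mean_deviation x = mean_deficit x + mean_deficit x.
Proof.
have HQ := integral_like_measure (Q x).
have h0 := ge0_measurable_deviation; have g0 := ge0_measurable_deficit.
(* The summand 1, read as the mean of w on the right, cancels at the end. *)
have : mean_deviation x + 1 = (mean_deficit x + mean_deficit x) + 1.
  transitivity (\int[Q x]_w (`|pos_part w - 1|%:E + 1%:E)).
    by rewrite [RHS](integral_likeD HQ h0 (ge0_measurable_cst _ lee01)) integral_kernel_cst.
  rewrite [RHS]addeC -[in RHS](mean_pos_part x).
  have gg0 := ge0_measurableD g0 g0.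
  rewrite /mean_deficit -[in RHS](integral_likeD HQ g0 g0).
  rewrite -[RHS](integral_likeD HQ ge0_measurable_pos_part gg0).
  by apply: eq_integral => w _; rewrite -!EFinD abs_sub1_deficit.
by move=> /(congr1 (fun z => z - 1)); rewrite !addeK.
Qed.

Lemma ge0_measurable_mean_deficit : ge0_measurable mean_deficit.
Proof.
apply: (ge0_measurable_integral_kernel Q (@measurable_id _ X setT)
  (f := fun z => (Num.max (1 - pos_part z.2) 0)%:E)).
exact: (ge0_measurable_comp (@measurable_snd _ _ X mR) ge0_measurable_deficit).
Qed.

End mean_deviation.

(** * The acceptance rate of the pseudo-marginal chain *)

(** The two integrals commute since the values of probability kernels are
    s-finite measures. *)
Lemma kernel_fubini d1 d2 d3 d4 (T1 : measurableType d1) (T2 : measurableType d2)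
    (Y : measurableType d3) (Z : measurableType d4) (R : realType)
    (k1 : R.-pker T1 ~> Y) (k2 : R.-pker T2 ~> Z) x1 x2 (f : Y * Z -> \bar R) :
  (forall z, 0 <= f z) -> measurable_fun [set: Y * Z] f ->
  \int[k1 x1]_y \int[k2 x2]_z f (y, z) = \int[k2 x2]_z \int[k1 x1]_y f (y, z).
Proof.
pose i1 := isSFinite.Build _ _ _ (k1 x1) (sfinite_kernel_measure k1 x1).
pose i2 := isSFinite.Build _ _ _ (k2 x2) (sfinite_kernel_measure k2 x2).
pose m1 : {sfinite_measure set Y -> \bar R} := HB.pack (Measure.sort (k1 x1)) i1.
pose m2 : {sfinite_measure set Z -> \bar R} := HB.pack (Measure.sort (k2 x2)) i2.
move=> f0 mf; exact: (@sfinite_Fubini _ _ Y Z R m1 m2 f f0 mf).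
Qed.

Section pseudo_marginal_rate.
Context d (X : measurableType d) (R : realType).
Variables (pi : probability X R) (q : R.-pker X ~> X) (r : X -> X -> R).
Hypothesis hr : tierney_ratio pi q r.
Variables (W : set (measurableTypeR R)) (Q : R.-pker X ~> measurableTypeR R).
Hypothesis mW : measurable W.
Hypothesis W_ge0 : forall w : R, W w -> (0 <= w)%R.
Hypothesis QW : forall x, Q x (~` W) = 0.
Hypothesis Q_mean1 : forall x, \int[Q x]_(w in W) w%:E = 1.

Local Notation mR := (measurableTypeR R).

Let weighted_integral x (f : mR -> \bar R) : \bar R :=
  \int[Q x]_w ((pos_part w)%:E * f w).

Let integral_pm_target f : ge0_measurable f ->
  \int[pm_target pi W Q]_z f z =
  \int[pi]_x weighted_integral x (fun w => f (x, w)).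
Proof.
apply: integral_semidirect => [x A|x A mA|x|g g0].
- by apply: integral_ge0 => w [_ /W_ge0]; rewrite lee_fin.
- rewrite /weighted integral_mkcondl; apply: integral_carrier => //.
    apply: ge0_measurableM; first exact: ge0_measurable_pos_part.
    exact: ge0_measurable_indic.
  move=> w /W_ge0 w0; rewrite patchE pos_part_id// indicE.
  by case: ifP => _; rewrite ?mule1 ?mule0.
- apply: (@integral_like_density _ mR R (fun f => \int[Q x]_w f w) (@pos_part R)).
  + exact: integral_like_measure.
  + exact: measurable_pos_part.
  + exact: pos_part_ge0.
- apply: (ge0_measurable_integral_kernel Q (@measurable_id _ X setT)
    (f := fun z => (pos_part z.2)%:E * g z) _).1.
  apply: ge0_measurableM g0.
  exact: (ge0_measurable_comp (@measurable_snd _ _ X mR) (@ge0_measurable_pos_part R)).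
Qed.

(* A point ((x, w), y) is a state of the chain with a proposed move. *)
Let state := ((X * mR) * X)%type.

Let mx : measurable_fun [set: state * mR] (fun z => z.1.1.1).
Proof. by do 2 apply: (measurableT_comp measurable_fst) => //. Qed.

Let my : measurable_fun [set: state * mR] (fun z => z.1.2).
Proof. by apply: (measurableT_comp measurable_snd). Qed.

Let mw : measurable_fun [set: state * mR] (fun z => pos_part z.1.1.2).
Proof.
apply: (measurableT_comp (@measurable_pos_part R)).
apply: (measurableT_comp measurable_snd).
by apply: (measurableT_comp measurable_fst).
Qed.

Let mu : measurable_fun [set: state * mR] (fun z => pos_part z.2).
Proof.
exact: (measurableT_comp (@measurable_pos_part R)).
Qed.

Let mr : measurable_fun [set: state * mR] (fun z => r z.1.1.1 z.1.2).
Proof.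
exact: (measurableT_comp (measurable_ratio hr) (measurable_fun_pair mx my)).
Qed.

Let accept0 : ge0_measurable (fun z : state * mR =>
  (pm_accept r z.1.1.1 (pos_part z.1.1.2) z.1.2 (pos_part z.2))%:E).
Proof.
apply: ge0_measurable_EFin => [|z]; last first.
  rewrite /pm_accept; case: ifP => // _.
  by rewrite le_min ler01 mulr_ge0 ?divr_ge0 ?pos_part_ge0// (ratio_ge0 hr).
apply: measurable_fun_ifT => //; first exact: measurable_fun_eqr.
apply: measurable_minr => //; apply: measurable_funM => //.
apply: measurable_funM => //.
(* The inverse of a nonnegative weight is its real power of exponent -1, which
   is a measurable function of the weight. *)
rewrite (_ : (fun z => _) = (fun z : state * mR => pos_part z.1.1.2 `^ (-1))%R).
  exact: (measurableT_comp (@measurable_powR R (-1)) mw).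
by apply/funext => z; rewrite powR_inv1 ?pos_part_ge0.
Qed.

Let joint_min (z : state) : \bar R :=
  \int[Q z.2]_u (Num.min (pos_part z.1.2) (r z.1.1 z.2 * pos_part u))%:E.

Let joint_min0 : ge0_measurable joint_min.
Proof.
apply: (ge0_measurable_integral_kernel Q (@measurable_snd _ _ (X * mR)%type X)
  (f := fun z => (Num.min (pos_part z.1.1.2) (r z.1.1.1 z.1.2 * pos_part z.2))%:E)).
apply: ge0_measurable_EFin => [|z].
  by apply: measurable_minr => //; exact: measurable_funM.
by rewrite le_min mulr_ge0 ?pos_part_ge0// (ratio_ge0 hr).
Qed.

Let accept_u (z : state) : \bar R :=
  \int[Q z.2]_u (pm_accept r z.1.1 (pos_part z.1.2) z.2 (pos_part u))%:E.

Let accept_u0 : ge0_measurable accept_u.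
Proof.
exact: (ge0_measurable_integral_kernel Q (@measurable_snd _ _ (X * mR)%type X)
  accept0).
Qed.

Let accept_yu (z : X * mR) : \bar R := \int[q z.1]_y accept_u (z, y).

Let accept_yu0 : ge0_measurable accept_yu.
Proof.
exact: (ge0_measurable_integral_kernel q (@measurable_fst _ _ X mR) accept_u0).
Qed.

Let weighted_accept_u z : (pos_part z.1.2)%:E * accept_u z = joint_min z.
Proof.
have acz : ge0_measurable (fun u : mR =>
    (pm_accept r z.1.1 (pos_part z.1.2) z.2 (pos_part u))%:E).
  exact: (ge0_measurable_comp (@pair1_measurable _ _ state mR z) accept0).
rewrite -(integral_likeZ (integral_like_measure (Q z.2)) (pos_part_ge0 _) acz).
apply: eq_integral => u _; rewrite -EFinM weight_pm_accept ?pos_part_ge0//.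
exact: ratio_ge0 hr _ _.
Qed.

(** The function H(x, y) = E min(w, r(x, y) u). *)
Definition mean_min (z : X * X) : \bar R :=
  \int[Q z.1]_w \int[Q z.2]_u
    (Num.min (pos_part w) (r z.1 z.2 * pos_part u))%:E.

Lemma ge0_measurable_mean_min : ge0_measurable mean_min.
Proof.
apply: (ge0_measurable_integral_kernel Q (@measurable_fst _ _ X X)
  (f := fun z => joint_min ((z.1.1, z.2), z.1.2))).
apply: (ge0_measurable_comp _ joint_min0).
apply: measurable_fun_pair; first apply: measurable_fun_pair => //.
- by apply: (measurableT_comp measurable_fst).
- by apply: (measurableT_comp measurable_snd).
Qed.

Let mean_accept x : \int[Q x]_w ((pos_part w)%:E * accept_yu (x, w)) =
  \int[q x]_y mean_min (x, y).
Proof.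
have jx : ge0_measurable (fun z : mR * X => joint_min ((x, z.1), z.2)).
  apply: (ge0_measurable_comp _ joint_min0).
  by apply: measurable_fun_pair => //; exact: measurable_fun_pair.
transitivity (\int[Q x]_w \int[q x]_y joint_min ((x, w), y)).
  apply: eq_integral => w _.
  have aw : ge0_measurable (fun y => accept_u ((x, w), y)).
    exact: (ge0_measurable_comp (@pair1_measurable _ _ (X * mR)%type X (x, w))
      accept_u0).
  rewrite -(integral_likeZ (integral_like_measure (q x)) (pos_part_ge0 _) aw).
  by apply: eq_integral => y _; exact: weighted_accept_u (x, w, y).
exact: (kernel_fubini Q q x x jx.2 jx.1).
Qed.

(** The weight w in the target turns the acceptance probability into
    min(w, r u); the remaining integrals over w and y commute. *)
Lemma pm_rateE : pm_rate pi q W Q r = proposal_integral pi q mean_min.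
Proof.
pose f (z : X * mR) : \bar R := (\1_W z.2)%:E * accept_yu z.
have W0 : ge0_measurable (fun w : mR => (\1_W w : R)%:E).
  exact: ge0_measurable_indic.
have f0 : ge0_measurable f.
  apply: ge0_measurableM accept_yu0.
  exact: (ge0_measurable_comp (@measurable_snd _ _ X mR) W0).
transitivity (\int[pm_target pi W Q]_z f z).
  rewrite /pm_rate /integral patch_setT.
  suff -> : (fun z : X * mR => \int[q z.1]_y \int[Q y]_(u in W)
      (pm_accept r z.1 z.2 y u)%:E) \_ ([set: X] `*` W) = f by [].
  apply/funext => -[x w]; rewrite patchE /f indicE/=.
  have -> : ((x, w) \in [set: X] `*` W) = (w \in W).
    by apply/idP/idP => [/set_mem[_ Ww]|/set_mem Ww]; exact/mem_set.
  case: ifPn => [/set_mem Ww|_]; last by rewrite mul0e.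
  rewrite mul1e; apply: eq_integral => y _; apply: integral_carrier => //.
    exact: (ge0_measurable_comp (@pair1_measurable _ _ state mR (x, w, y)) accept0).
  by move=> u Wu; rewrite /= !pos_part_id ?W_ge0.
rewrite integral_pm_target//; apply: eq_integral => x _; rewrite -mean_accept.
have wx : ge0_measurable (fun w => (pos_part w)%:E * accept_yu (x, w)).
  apply: ge0_measurableM; first exact: ge0_measurable_pos_part.
  exact: (ge0_measurable_comp (@pair1_measurable _ _ X mR x) accept_yu0).
have wfx : ge0_measurable (fun w => (pos_part w)%:E * f (x, w)).
  apply: ge0_measurableM; first exact: ge0_measurable_pos_part.
  exact: (ge0_measurable_comp (@pair1_measurable _ _ X mR x) f0).
rewrite /weighted_integral -(integral_carrier mW (QW x) wfx (fun _ _ => erefl)).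
apply: integral_carrier => // w Ww.
by rewrite /f indicE/= mem_set// mul1e.
Qed.

Let integralQ x := integral_like_measure (Q x).

Let pos_part0 := @ge0_measurable_pos_part R.

Let deficit0 := @ge0_measurable_deficit R.

Let min_pos_part0 z w : ge0_measurable (fun u : mR =>
  (Num.min (pos_part w) (r z.1 z.2 * pos_part u))%:E).
Proof.
apply: ge0_measurable_EFin => [|u].
  apply: measurable_minr => //; apply: measurable_funM => //.
  exact: measurable_pos_part.
by rewrite le_min mulr_ge0 ?pos_part_ge0// (ratio_ge0 hr).
Qed.

Let joint_min_section0 z : ge0_measurable (fun w : mR => \int[Q z.2]_u
  (Num.min (pos_part w) (r z.1 z.2 * pos_part u))%:E).
Proof.
apply: (ge0_measurable_comp (phi := fun w => ((z.1, w), z.2)) _ joint_min0).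
by apply: measurable_fun_pair => //; exact: measurable_fun_pair.
Qed.

(** A minimum is at most each of its arguments, whose means are 1 and r. *)
Lemma mean_min_le z : mean_min z <= (mh_accept r z.1 z.2)%:E.
Proof.
have r0 : (0 <= r z.1 z.2)%R by exact: ratio_ge0 hr _ _.
rewrite /mh_accept EFin_min le_min; apply/andP; split.
- rewrite -[leRHS](mean_pos_part mW W_ge0 QW Q_mean1 z.1).
  apply: (integral_like_le (integralQ _)) => // w.
  rewrite -[leRHS](integral_kernel_cst Q z.2).
  apply: (integral_like_le (integralQ _)) => //.
    by apply: ge0_measurable_cst; rewrite lee_fin pos_part_ge0.
  by move=> u; rewrite lee_fin ge_min lexx.
- rewrite -[leRHS](integral_kernel_cst Q z.1).
  apply: (integral_like_le (integralQ _)) => // w.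
  rewrite -[leRHS]mule1 -(mean_pos_part mW W_ge0 QW Q_mean1 z.2).
  rewrite -(integral_likeZ (integralQ _) r0 pos_part0).
  apply: (integral_like_le (integralQ _)) => // [|u].
    by apply: ge0_measurableM => //; apply: ge0_measurable_cst; rewrite lee_fin.
  by rewrite -EFinM lee_fin ge_min lexx orbT.
Qed.

(** The average of [le_min_add_deficits] over w and u, with m = a(x, y). *)
Lemma mh_accept_le_mean_min z :
  (mh_accept r z.1 z.2)%:E <= mean_min z +
    ((mh_accept r z.1 z.2)%:E * mean_deficit Q z.1 +
     (mh_accept r z.1 z.2)%:E * mean_deficit Q z.2).
Proof.
set m := mh_accept _ _ _.
have m0 : (0 <= m)%R by exact: mh_accept_ge0 hr _ _.
have m1 : (m <= 1)%R by exact: mh_accept_le1.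
have mr' : (m <= r z.1 z.2)%R by rewrite /m /mh_accept ge_min lexx orbT.
have cst0 c : 0 <= c -> @ge0_measurable _ mR R (fun=> c).
  by move=> c0; exact: ge0_measurable_cst.
have mE0 : 0 <= m%:E by rewrite lee_fin.
have md0 : @ge0_measurable _ mR R (fun w => m%:E * (Num.max (1 - pos_part w) 0)%:E).
  by apply: ge0_measurableM => //; exact: cst0.
have md x : m%:E * mean_deficit Q x =
    \int[Q x]_w (m%:E * (Num.max (1 - pos_part w) 0)%:E).
  by rewrite (integral_likeZ (integralQ x)).
have mD0 x : 0 <= m%:E * mean_deficit Q x.
  by rewrite mule_ge0// (integral_like_ge0 (integralQ x)).
(* The average over u for a fixed weight w. *)
have inner w : m%:E <= \int[Q z.2]_u
    (Num.min (pos_part w) (r z.1 z.2 * pos_part u))%:E +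
    (m%:E * (Num.max (1 - pos_part w) 0)%:E + m%:E * mean_deficit Q z.2).
  have mw0 : 0 <= m%:E * (Num.max (1 - pos_part w) 0)%:E by exact: md0.2.
  rewrite -[X in _ + (X + _)](integral_kernel_cst Q z.2) md.
  rewrite -(integral_likeD (integralQ _) (cst0 _ mw0) md0).
  rewrite -(integral_likeD (integralQ _)) //; last first.
    by apply: ge0_measurableD => //; exact: cst0.
  rewrite -[leLHS](integral_kernel_cst Q z.2).
  apply: (integral_like_le (integralQ _)) => [||u].
  - exact: cst0.
  - by do 2 ?apply: ge0_measurableD => //; exact: cst0.
  - rewrite -!EFinM -!EFinD lee_fin.
    by apply: le_min_add_deficits => //; exact: pos_part_ge0.
rewrite md -[X in _ + (_ + X)](integral_kernel_cst Q z.1).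
rewrite -(integral_likeD (integralQ _) md0 (cst0 _ (mD0 _))).
rewrite -(integral_likeD (integralQ _)) //; last first.
  by apply: ge0_measurableD => //; exact: cst0.
rewrite -[leLHS](integral_kernel_cst Q z.1).
apply: (integral_like_le (integralQ _)) => [||w].
- exact: cst0.
- by do 2 ?apply: ge0_measurableD => //; exact: cst0.
- exact: inner.
Qed.

End pseudo_marginal_rate.

(** * Comparison of the acceptance rates *)

(** The upper bound on [a] keeps both numbers finite, so that the subtraction of
    extended reals is cancellable. *)
Lemma sube_bounds (R : realDomainType) (a b c : \bar R) :
  0 <= b -> b <= a -> a <= 1 -> a <= b + c -> 0 <= a - b /\ a - b <= c.
Proof.
move=> b0 ba a1 abc.
have b_fin : b \is a fin_num.
  by rewrite ge0_fin_numE// (le_lt_trans (le_trans ba a1))// ltry.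
by rewrite sube_ge0 ?b_fin// leeBlDr// addeC.
Qed.

Section acceptance_rates.
Context d (X : measurableType d) (R : realType).
Variables (pi : probability X R) (q : R.-pker X ~> X) (r : X -> X -> R).
Hypothesis hr : tierney_ratio pi q r.
Variables (W : set (measurableTypeR R)) (Q : R.-pker X ~> measurableTypeR R).
Hypothesis mW : measurable W.
Hypothesis W_ge0 : forall w : R, W w -> (0 <= w)%R.
Hypothesis QW : forall x, Q x (~` W) = 0.
Hypothesis Q_mean1 : forall x, \int[Q x]_(w in W) w%:E = 1.

Let m (z : X * X) : \bar R := (mh_accept r z.1 z.2)%:E.

Let m0 : ge0_measurable m.
Proof. exact: ge0_measurable_mh_accept hr. Qed.

Let mx0 x : ge0_measurable (fun y => m (x, y)).
Proof. exact: (ge0_measurable_comp (@pair1_measurable _ _ X X x) m0). Qed.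

Let G : X -> \bar R := mean_deficit Q.

Let G0 : ge0_measurable G.
Proof. exact: ge0_measurable_mean_deficit. Qed.

Let mG1 : ge0_measurable (fun z => m z * G z.1).
Proof.
apply: ge0_measurableM m0 _.
exact: (ge0_measurable_comp (@measurable_fst _ _ X X) G0).
Qed.

Let mG2 : ge0_measurable (fun z => m z * G z.2).
Proof.
apply: ge0_measurableM m0 _.
exact: (ge0_measurable_comp (@measurable_snd _ _ X X) G0).
Qed.

Definition accept_rate x : \bar R := \int[q x]_y (mh_accept r x y)%:E.

Lemma ge0_measurable_accept_rate : ge0_measurable accept_rate.
Proof. exact: (ge0_measurable_integral_kernel q (@measurable_id _ X setT) m0). Qed.

Lemma accept_rate_le1 x : accept_rate x <= 1.
Proof.
rewrite -[leRHS](integral_kernel_cst q x).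
apply: (integral_like_le (integral_like_measure (q x))) => [||y].
- exact: mx0.
- exact: ge0_measurable_cst.
- by rewrite lee_fin mh_accept_le1.
Qed.

Lemma mh_rejectionK x : 1 - mh_rejection q r x = accept_rate x.
Proof.
have rate_fin : accept_rate x \is a fin_num.
  rewrite ge0_fin_numE; last exact: (ge0_measurable_accept_rate.2 x).
  exact: le_lt_trans (accept_rate_le1 x) (ltry 1).
by rewrite /mh_rejection -/(accept_rate x) fin_num_oppeB// addeA subee// add0e.
Qed.

Lemma mh_rate_le1 : mh_rate pi q r <= 1.
Proof.
rewrite -(@probability_setT _ _ _ pi) -[leRHS]mul1e -integral_cst//.
apply: (integral_like_le (integral_like_measure pi)) => [||x].
- exact: ge0_measurable_accept_rate.
- exact: ge0_measurable_cst.
- exact: accept_rate_le1.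
Qed.

Lemma abs_deviationE x : \int[Q x]_(w in W) `|w - 1|%:E = G x + G x.
Proof.
rewrite -(mean_deviationE mW W_ge0 QW Q_mean1).
apply: integral_carrier => //; first exact: ge0_measurable_deviation.
by move=> w /W_ge0 w0; rewrite pos_part_id.
Qed.

Lemma accepted_deviationE x :
  \int[Q x]_(w in W) (`|w - 1|%:E * (1 - mh_rejection q r x)) =
  accept_rate x * (G x + G x).
Proof.
rewrite mh_rejectionK -abs_deviationE [RHS]muleC [LHS]ge0_integralZr//.
  apply/measurable_EFinP; apply: measurableT_comp => //.
  exact: measurable_funB.
exact: (ge0_measurable_accept_rate.2 x).
Qed.

(** By detailed balance, the deficit at the proposed state contributes as much as
    the deficit at the current one. *)
Lemma integral_accepted_deficit :
  \int[pi]_x (accept_rate x * (G x + G x)) =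
  proposal_integral pi q (fun z => m z * G z.1) +
  proposal_integral pi q (fun z => m z * G z.2).
Proof.
have HL := integral_like_proposal pi q.
have G1 : ge0_measurable (fun z : X * X => G z.1).
  exact: (ge0_measurable_comp (@measurable_fst _ _ X X) G0).
have -> : proposal_integral pi q (fun z => m z * G z.2) =
    proposal_integral pi q (fun z => m z * G z.1) := detailed_balance hr G1.
rewrite -(integral_likeD HL mG1 mG1); apply: eq_integral => x _.
have GG0 : 0 <= G x + G x := adde_ge0 (G0.2 x) (G0.2 x).
transitivity (\int[q x]_y (m (x, y) * (G x + G x))).
  exact/esym/(ge0_integralZr _ measurableT (mx0 x).1 (fun y _ => m0.2 (x, y)) GG0).
by apply: eq_integral => y _; apply: ge0_muleDr; exact: G0.2.
Qed.

Lemma pm_rate_ge0 : 0 <= pm_rate pi q W Q r.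
Proof.
rewrite (pm_rateE hr mW W_ge0 QW).
exact: (integral_like_ge0 (integral_like_proposal pi q)
  (ge0_measurable_mean_min hr Q)).
Qed.

Lemma pm_rate_le : pm_rate pi q W Q r <= mh_rate pi q r.
Proof.
rewrite (pm_rateE hr mW W_ge0 QW).
have HL := integral_like_proposal pi q.
apply: (integral_like_le HL (ge0_measurable_mean_min hr Q) m0) => z.
exact: (mean_min_le hr mW W_ge0 QW Q_mean1).
Qed.

Lemma mh_rate_le_pm_rate : mh_rate pi q r <=
  pm_rate pi q W Q r + \int[pi]_x (accept_rate x * (G x + G x)).
Proof.
have HL := integral_like_proposal pi q.
have mean0 := ge0_measurable_mean_min hr Q.
have mG0 := ge0_measurableD mG1 mG2.
rewrite (pm_rateE hr mW W_ge0 QW) integral_accepted_deficit.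
rewrite -(integral_likeD HL mG1 mG2) -(integral_likeD HL mean0 mG0).
apply: (integral_like_le HL m0 (ge0_measurableD mean0 mG0)) => z.
exact: (mh_accept_le_mean_min hr Q z).
Qed.

Lemma integral_accepted_deviation_le :
  \int[pi]_x (accept_rate x * (G x + G x)) <= \int[pi]_x (G x + G x).
Proof.
have GG0 := ge0_measurableD G0 G0.
apply: (integral_like_le (integral_like_measure pi)) => [||x].
- exact: ge0_measurableM ge0_measurable_accept_rate GG0.
- exact: GG0.
- rewrite -[leRHS]mul1e; apply: lee_wpmul2r; first exact: (GG0.2 x).
  exact: accept_rate_le1.
Qed.

End acceptance_rates.

Theorem corollary4 (R : realType) (d : measure_display) (X : measurableType d)
    (pi : probability X R) (q : R.-pker X ~> X)
    (r : X -> X -> R) (hr : tierney_ratio pi q r)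
    (W : set (measurableTypeR R)) (mW : measurable W)
    (W_ge0 : forall w : R, W w -> (0 <= w)%R)
    (Q : R.-pker X ~> measurableTypeR R)
    (QW : forall x, Q x (~` W) = 0)
    (Q_mean1 : forall x, \int[Q x]_(w in W) w%:E = 1) :
  let alpha_P := mh_rate pi q r in
  let alpha_Pt := pm_rate pi q W Q r in
  [/\ 0 <= alpha_P - alpha_Pt,
      alpha_P - alpha_Pt <=
        \int[pi]_x \int[Q x]_(w in W) (`|w - 1|%:E * (1 - mh_rejection q r x))
    & \int[pi]_x \int[Q x]_(w in W) (`|w - 1|%:E * (1 - mh_rejection q r x))
        <= \int[pi]_x \int[Q x]_(w in W) `|w - 1|%:E].
Proof.
move=> alpha_P alpha_Pt.
have -> : \int[pi]_x \int[Q x]_(w in W)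
      (`|w - 1|%:E * (1 - mh_rejection q r x)) =
    \int[pi]_x (accept_rate q r x * (mean_deficit Q x + mean_deficit Q x)).
  by apply: eq_integral => x _; exact: (accepted_deviationE hr mW W_ge0 QW Q_mean1 x).
have -> : \int[pi]_x \int[Q x]_(w in W) `|w - 1|%:E =
    \int[pi]_x (mean_deficit Q x + mean_deficit Q x).
  by apply: eq_integral => x _; exact: (abs_deviationE mW W_ge0 QW Q_mean1 x).
have [gap_ge0 gap_le] := sube_bounds
  (pm_rate_ge0 hr mW W_ge0 QW)
  (pm_rate_le hr mW W_ge0 QW Q_mean1)
  (mh_rate_le1 hr)
  (mh_rate_le_pm_rate hr mW W_ge0 QW).
split.
- exact: gap_ge0.
- exact: gap_le.
- exact: (integral_accepted_deviation_le hr Q).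
Qed.
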